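(* Let $\mathcal{L}$ be a many-sorted signature in which every relation symbol and every function symbol is strict. Let $\Gamma\cup\{\varphi\}$ be a set of well-sorted $\mathcal{L}$-formulas that do not contain the equality sign. Then $$\Gamma\vdash_{\mathrm{MSL}}\varphi\quad\text{if and only if}\quad \Gamma\vdash_{\mathrm{FOL}}\varphi,$$ where on the right-hand side the formulas are read as ordinary unsorted first-order formulas (sorted variables being treated as ordinary variables).
   Context: A many-sorted signature $\mathcal{L}$ consists of countable sets of relation symbols and function symbols, each with an arity $n\ge 0$ (0-ary function symbols are constants); a nonempty countable set $\mathrm{Sort}$ of sorts; pairwise disjoint countably infinite sets $\mathrm{Var}_i$ of variables of sort $i$ (one for each $i\in\mathrm{Sort}$), written $x^i$; and a function $\mathrm{rank}$ assigning to each $n$-ary relation symbol $R$ a nonempty set $\mathrm{rank}(R)\subseteq\mathrm{Sort}^n$, and to each $n$-ary function symbol $f$ a nonempty set $\mathrm{rank}(f)\subseteq \mathrm{Sort}^n\times\mathrm{Sort}$ that is a partial function (for each $(i_1,\dots,i_n)$ there is at most one $i$ with $(i_1,\dots,i_n,i)\in\mathrm{rank}(f)$). $R$ is strict if $\mathrm{rank}(R)$ is a singleton; $f$ is strict if the domain of $\mathrm{rank}(f)$ is a singleton. Well-sorted terms: each $x\in\mathrm{Var}_i$ is a term of sort $i$; if $t_1,\dots,t_n$ are terms of sorts $i_1,\dots,i_n$ and $(i_1,\dots,i_n,i)\in\mathrm{rank}(f)$ then $f(t_1,\dots,t_n)$ is a term of sort $i$. Well-sorted formulas: $\bot$; $t_1=t_2$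 for terms of the same sort; $R(t_1,\dots,t_n)$ when the tuple of sorts of the $t_k$ lies in $\mathrm{rank}(R)$; closure under $\land,\lor,\to$ and under $\exists x^i,\forall x^i$. $\Gamma\vdash_{\mathrm{MSL}}\varphi$ means $\varphi$ is derivable from $\Gamma$ in classical natural deduction (introduction/elimination rules for $\land,\lor,\to$, ex falso for $\bot$, reductio ad absurdum, and sorted quantifier rules: $\forall I$/$\exists E$ with the usual eigenvariable conditions, and $\forall E$/$\exists I$ instantiating a variable of sort $i$ only by a well-sorted term of sort $i$ free for it), where every formula in the derivation is a well-sorted $\mathcal{L}$-formula, together with the universal closures of the sorted equality axioms $x^i=x^i$, $x^i=y^i\to y^i=x^i$, $x^i=y^i\land y^i=z^i\to x^i=z^i$, $\bigwedge_k x_k^{i_k}=y_k^{i_k}\to(R(\vec x)\to R(\vec y))$ for $(i_1,\dots,i_n)\in\mathrm{rank}(R)$, and $\bigwedge_k x_k^{i_k}=y_k^{i_k}\to f(\vec x)=f(\vec y)$ for $(i_1,\dots,i_n)$ in the domain of $\mathrm{rank}(f)$. $\Pi\vdash_{\mathrm{FOL}}A$ means $A$ is derivable from $\Pi$ in classical unsorted natural deduction for first-order logic together with the universal closures of the usual equality axioms (reflexivity, symmetry, transitivity, and congruence for every relation and function symbol). *)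

(* Defs.v *)
From mathcomp Require Import all_boot.
From mathcomp Require Import boolp classical_sets.

Set Implicit Arguments.
Unset Strict Implicit.
Unset Printing Implicit Defensive.

Local Open Scope classical_set_scope.

(* [fun_rank f s i] means that (s_1, ..., s_n, i) belongs to rank(f). *)
Record signature := Signature {
  relsym : countType;
  funsym : countType;
  sorts : countType;
  sorts_inhabited : inhabited sorts;
  rel_arity : relsym -> nat;
  fun_arity : funsym -> nat;
  rel_rank : forall R : relsym, {ffun 'I_(rel_arity R) -> sorts} -> Prop;
  rel_rank_nonempty : forall R, exists s, @rel_rank R s;
  fun_rank : forall f : funsym, {ffun 'I_(fun_arity f) -> sorts} -> sorts -> Prop;
  fun_rank_nonempty : forall f, exists s i, @fun_rank f s i;
  fun_rank_functional : forall f s i j,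
    @fun_rank f s i -> @fun_rank f s j -> i = j
}.

Definition strict_rel (L : signature) (R : relsym L) : Prop :=
  exists! s, @rel_rank L R s.

Definition strict_fun (L : signature) (f : funsym L) : Prop :=
  exists! s, exists i, @fun_rank L f s i.

(* The variable (i, n) is the n-th variable of sort i. *)
Definition var (L : signature) : countType := (sorts L * nat)%type.

Definition var_sort (L : signature) (x : var L) : sorts L := x.1.

(* Terms and formulas are unsorted (only arities are enforced by the syntax);
   the well-sorted ones are singled out by [term_has_sort] and [well_sorted].
   Hence a well-sorted formula is itself a formula of unsorted logic. *)
Inductive term (L : signature) : Type :=
| Var of var L
| App (f : funsym L) of {ffun 'I_(fun_arity f) -> term L}.

Inductive formula (L : signature) : Type :=
| Bot
| Eq of term L & term L
| Rel (R : relsym L) of {ffun 'I_(rel_arity R) -> term L}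
| And of formula L & formula L
| Or of formula L & formula L
| Imp of formula L & formula L
| Ex of var L & formula L
| All of var L & formula L.

Arguments Bot {L}.

Inductive term_has_sort (L : signature) : term L -> sorts L -> Prop :=
| Var_sort x : term_has_sort (Var x) (var_sort x)
| App_sort f (ts : {ffun 'I_(fun_arity f) -> term L})
    (s : {ffun 'I_(fun_arity f) -> sorts L}) i :
    (forall k, term_has_sort (ts k) (s k)) -> @fun_rank L f s i ->
    term_has_sort (App ts) i.

Fixpoint well_sorted (L : signature) (A : formula L) : Prop :=
  match A with
  | Bot => True
  | Eq t u => exists i, term_has_sort t i /\ term_has_sort u i
  | Rel R ts => exists s : {ffun _ -> sorts L},
      (forall k, term_has_sort (ts k) (s k)) /\ @rel_rank L R s
  | And B C | Or B C | Imp B C => well_sorted B /\ well_sorted C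
  | Ex _ B | All _ B => well_sorted B
  end.

Fixpoint eq_free (L : signature) (A : formula L) : bool :=
  match A with
  | Bot | Rel _ _ => true
  | Eq _ _ => false
  | And B C | Or B C | Imp B C => eq_free B && eq_free C
  | Ex _ B | All _ B => eq_free B
  end.

Fixpoint term_fv (L : signature) (t : term L) : seq (var L) :=
  match t with
  | Var x => [:: x]
  | App f ts => flatten [seq term_fv (ts k) | k <- enum 'I_(fun_arity f)]
  end.

Fixpoint fv (L : signature) (A : formula L) : seq (var L) :=
  match A with
  | Bot => [::]
  | Eq t u => term_fv t ++ term_fv u
  | Rel R ts => flatten [seq term_fv (ts k) | k <- enum 'I_(rel_arity R)]
  | And B C | Or B C | Imp B C => fv B ++ fv C
  | Ex x B | All x B => [seq y <- fv B | y != x]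
  end.

Fixpoint term_subst (L : signature) (x : var L) (t u : term L) : term L :=
  match u with
  | Var y => if y == x then t else Var y
  | App f ts => App [ffun k => term_subst x t (ts k)]
  end.

(* Replacement of the free occurrences of x by t, without renaming of bound
   variables; it is only used together with [free_for]. *)
Fixpoint subst (L : signature) (x : var L) (t : term L) (A : formula L)
    : formula L :=
  match A with
  | Bot => Bot
  | Eq u v => Eq (term_subst x t u) (term_subst x t v)
  | Rel R ts => Rel [ffun k => term_subst x t (ts k)]
  | And B C => And (subst x t B) (subst x t C)
  | Or B C => Or (subst x t B) (subst x t C)
  | Imp B C => Imp (subst x t B) (subst x t C)
  | Ex y B => Ex y (if y == x then B else subst x t B)
  | All y B => All y (if y == x then B else subst x t B)
  end.

Fixpoint free_for (L : signature) (t : term L) (x : var L) (A : formula L)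
    : bool :=
  match A with
  | Bot | Eq _ _ | Rel _ _ => true
  | And B C | Or B C | Imp B C => free_for t x B && free_for t x C
  | Ex y B | All y B =>
      (x \notin fv A) || ((y \notin term_fv t) && free_for t x B)
  end.

Definition Neg (L : signature) (A : formula L) : formula L := Imp A Bot.

Fixpoint conj_seq (L : signature) (As : seq (formula L)) : formula L :=
  match As with
  | [::] => Neg Bot
  | [:: A] => A
  | A :: Bs => And A (conj_seq Bs)
  end.

Definition universal_closure (L : signature) (A : formula L) : formula L :=
  foldr (@All L) A (undup (fv A)).

Section EqualityAxioms.
Variable L : signature.

Definition eq_var (x y : var L) : formula L := Eq (Var x) (Var y).

Definition eq_vars n (x y : {ffun 'I_n -> var L}) : formula L :=
  conj_seq [seq eq_var (x k) (y k) | k <- enum 'I_n].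

Definition refl_axiom x := eq_var x x.
Definition sym_axiom x y := Imp (eq_var x y) (eq_var y x).
Definition trans_axiom x y z :=
  Imp (And (eq_var x y) (eq_var y z)) (eq_var x z).
Definition rel_axiom (R : relsym L) (x y : {ffun 'I_(rel_arity R) -> var L}) :=
  Imp (eq_vars x y)
    (Imp (Rel [ffun k => Var (x k)]) (Rel [ffun k => Var (y k)])).
Definition fun_axiom (f : funsym L) (x y : {ffun 'I_(fun_arity f) -> var L}) :=
  Imp (eq_vars x y) (Eq (App [ffun k => Var (x k)]) (App [ffun k => Var (y k)])).

(* The axioms are schemes over all variables; the instances in which some of
   the variables coincide follow from those with distinct variables. *)
Inductive fol_eq_axiom : formula L -> Prop :=
| fol_refl x : fol_eq_axiom (universal_closure (refl_axiom x))
| fol_sym x y : fol_eq_axiom (universal_closure (sym_axiom x y))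
| fol_trans x y z : fol_eq_axiom (universal_closure (trans_axiom x y z))
| fol_rel R (x y : {ffun 'I_(rel_arity R) -> var L}) :
    fol_eq_axiom (universal_closure (rel_axiom x y))
| fol_fun f (x y : {ffun 'I_(fun_arity f) -> var L}) :
    fol_eq_axiom (universal_closure (fun_axiom x y)).

Definition sorts_of n (x : {ffun 'I_n -> var L}) : {ffun 'I_n -> sorts L} :=
  [ffun k => var_sort (x k)].

Inductive msl_eq_axiom : formula L -> Prop :=
| msl_refl x : msl_eq_axiom (universal_closure (refl_axiom x))
| msl_sym x y : var_sort x = var_sort y ->
    msl_eq_axiom (universal_closure (sym_axiom x y))
| msl_trans x y z : var_sort x = var_sort y -> var_sort y = var_sort z ->
    msl_eq_axiom (universal_closure (trans_axiom x y z))
| msl_rel R (x y : {ffun 'I_(rel_arity R) -> var L}) :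
    sorts_of x = sorts_of y -> @rel_rank L R (sorts_of x) ->
    msl_eq_axiom (universal_closure (rel_axiom x y))
| msl_fun f (x y : {ffun 'I_(fun_arity f) -> var L}) :
    sorts_of x = sorts_of y -> (exists i, @fun_rank L f (sorts_of x) i) ->
    msl_eq_axiom (universal_closure (fun_axiom x y)).

End EqualityAxioms.

Section NaturalDeduction.
Variables (L : signature).
(* The formulas allowed in a derivation, the terms that may instantiate a
   given variable, and the axioms. *)
Variables (ok : formula L -> Prop) (inst : var L -> term L -> Prop).
Variable (ax : formula L -> Prop).

(* [nd G A] holds iff some natural deduction tree has conclusion A and all its
   open assumptions in G.  The eigenvariable conditions of a tree only concern
   the assumptions that are actually open in it, whence the rule [nd_weak]. *)
Inductive nd : set (formula L) -> formula L -> Prop :=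
| nd_hyp G A : ok A -> G A -> nd G A
| nd_ax G A : ok A -> ax A -> nd G A
| nd_weak G H A : G `<=` H -> nd G A -> nd H A
| nd_andI G A B : ok (And A B) -> nd G A -> nd G B -> nd G (And A B)
| nd_andE1 G A B : ok A -> nd G (And A B) -> nd G A
| nd_andE2 G A B : ok B -> nd G (And A B) -> nd G B
| nd_orI1 G A B : ok (Or A B) -> nd G A -> nd G (Or A B)
| nd_orI2 G A B : ok (Or A B) -> nd G B -> nd G (Or A B)
| nd_orE G A B C : ok C -> nd G (Or A B) ->
    nd (G `|` [set A]) C -> nd (G `|` [set B]) C -> nd G C
| nd_impI G A B : ok (Imp A B) -> nd (G `|` [set A]) B -> nd G (Imp A B)
| nd_impE G A B : ok B -> nd G (Imp A B) -> nd G A -> nd G B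
| nd_botE G A : ok A -> nd G Bot -> nd G A
| nd_raa G A : ok A -> nd (G `|` [set Neg A]) Bot -> nd G A
| nd_allI G x A : ok (All x A) -> (forall B, G B -> x \notin fv B) ->
    nd G A -> nd G (All x A)
| nd_allE G x t A : ok (subst x t A) -> inst x t -> free_for t x A ->
    nd G (All x A) -> nd G (subst x t A)
| nd_exI G x t A : ok (Ex x A) -> inst x t -> free_for t x A ->
    nd G (subst x t A) -> nd G (Ex x A)
| nd_exE G x A C : ok C -> (forall B, G B -> x \notin fv B) -> x \notin fv C ->
    nd G (Ex x A) -> nd (G `|` [set A]) C -> nd G C.

End NaturalDeduction.

Definition msl_derives (L : signature) : set (formula L) -> formula L -> Prop :=
  nd (@well_sorted L) (fun x t => term_has_sort t (var_sort x)) (@msl_eq_axiom L).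

Definition fol_derives (L : signature) : set (formula L) -> formula L -> Prop :=
  nd (fun=> True) (fun _ _ => True) (@fol_eq_axiom L).

(* Main.v *)
(* The nontrivial direction interprets unsorted logic in many-sorted derivability.
   Unsorted variables range over the product of all sorts: a point assigns to
   each sort i a well-sorted term of sort i; by strictness, each argument of a
   symbol uses one fixed component of its point.  Formulas are forced at finite-support
   contexts, classically (disjunction and existence are read through double
   negation); an equation is forced when both sides are the same point, or the
   context is inconsistent.  All unsorted rules are sound for this forcing, while
   for an equality-free well-sorted formula forcing coincides with many-sorted
   derivability of the corresponding substitution instance, because the
   projection of the product onto each sort is surjective.  A derivation is
   first reduced to one of a closed sentence without assumptions; terms avoiding
   the bound variables of that sentence then suffice, so that no substitution
   captures. *)

From Stdlib Require List.
Require Import Defs.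
From mathcomp Require Import all_boot.
From mathcomp Require Import boolp classical_sets.

Set Implicit Arguments.
Unset Strict Implicit.
Unset Printing Implicit Defensive.

Local Open Scope classical_set_scope.

(** The arguments of [App] are nested in a finite function, so the induction hypothesis for them
    comes from an explicit fixpoint. *)
Lemma term_ind_ffun (L : signature) (P : term L -> Prop) :
  (forall x, P (Var x)) ->
  (forall f (ts : {ffun 'I_(fun_arity f) -> term L}),
     (forall k, P (ts k)) -> P (App ts)) ->
  forall t, P t.
Proof.
move=> PVar PApp; fix IH 1; case=> [x|f ts]; first exact: PVar.
by apply: PApp => k; apply: IH.
Qed.

Section Upd.
Variables (T : eqType) (V : Type).

Definition upd (f : T -> V) (x : T) (v : V) : T -> V :=
  fun y => if y == x then v else f y.

Lemma upd_same f x v : upd f x v x = v.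
Proof. by rewrite /upd eqxx. Qed.

Lemma upd_other f x v y : y != x -> upd f x v y = f y.
Proof. by rewrite /upd => /negbTE ->. Qed.

End Upd.

(** * Fresh variables, simultaneous substitution and renaming *)

Section Syntax.
Variable L : signature.
Implicit Types (x y z : var L) (t u : term L) (A B C : formula L).
Implicit Types (s : var L -> term L) (X : seq (var L)).

Lemma mem_flatten_ordP n (F : 'I_n -> seq (var L)) x :
  reflect (exists k, x \in F k) (x \in flatten [seq F k | k <- enum 'I_n]).
Proof.
apply: (iffP flatten_mapP) => [[k _ xk]|[k xk]]; exists k => //.
by rewrite mem_enum.
Qed.

Lemma fresh_var X (i : sorts L) : exists2 z : var L, z \notin X & z.1 = i.
Proof.
(* The index exceeds those of all members of [X], whatever their sorts. *)
exists (i, (\max_(y <- X) y.2).+1) => //=.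
apply/negP => iX; have := @leq_bigmax_seq _ X predT (@snd _ _) _ iX isT.
by rewrite /= ltnn.
Qed.

Fixpoint bv A : seq (var L) :=
  match A with
  | Bot | Eq _ _ | Rel _ _ => [::]
  | And B C | Or B C | Imp B C => bv B ++ bv C
  | Ex x B | All x B => x :: bv B
  end.

Fixpoint tsub s t : term L :=
  match t with
  | Var x => s x
  | App f ts => App [ffun k => tsub s (ts k)]
  end.

(* No renaming of bound variables: used only with terms that avoid the bound
   variables of the formula. *)
Fixpoint fsub s A : formula L :=
  match A with
  | Bot => Bot
  | Eq t u => Eq (tsub s t) (tsub s u)
  | Rel R ts => Rel [ffun k => tsub s (ts k)]
  | And B C => And (fsub s B) (fsub s C)
  | Or B C => Or (fsub s B) (fsub s C)
  | Imp B C => Imp (fsub s B) (fsub s C)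
  | Ex x B => Ex x (fsub (upd s x (Var x)) B)
  | All x B => All x (fsub (upd s x (Var x)) B)
  end.

Lemma mem_fv_bind x y B : (y \in [seq z <- fv B | z != x]) = (y != x) && (y \in fv B).
Proof. by rewrite mem_filter. Qed.

Lemma eq_tsub s s' t : {in term_fv t, s =1 s'} -> tsub s t = tsub s' t.
Proof.
elim/term_ind_ffun: t => [x|f ts IH] /= ss'; first by apply: ss'; rewrite inE.
congr App; apply/ffunP => k; rewrite !ffunE; apply: IH => x xk.
by apply: ss'; apply/mem_flatten_ordP; exists k.
Qed.

Lemma eq_upd (V : Type) (f g : var L -> V) x v B :
  {in [seq y <- fv B | y != x], f =1 g} -> {in fv B, upd f x v =1 upd g x v}.
Proof.
move=> fg y yB; rewrite /upd; case: eqVneq => // yx.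
by apply: fg; rewrite mem_fv_bind yx.
Qed.

Lemma eq_fsub s s' A : {in fv A, s =1 s'} -> fsub s A = fsub s' A.
Proof.
elim: A s s' => [|t u|R ts|B IB C IC|B IB C IC|B IB C IC|x B IB|x B IB] s s' //= ss'.
- by congr Eq; apply: eq_tsub => x xt; apply: ss'; rewrite mem_cat xt ?orbT.
- congr Rel; apply/ffunP => k; rewrite !ffunE; apply: eq_tsub => x xk.
  by apply: ss'; apply/mem_flatten_ordP; exists k.
- by congr And; [apply: IB|apply: IC] => x xB; apply: ss'; rewrite mem_cat xB ?orbT.
- by congr Or; [apply: IB|apply: IC] => x xB; apply: ss'; rewrite mem_cat xB ?orbT.
- by congr Imp; [apply: IB|apply: IC] => x xB; apply: ss'; rewrite mem_cat xB ?orbT.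
- by congr Ex; apply: IB; apply: eq_upd.
- by congr All; apply: IB; apply: eq_upd.
Qed.

Lemma tsub_id t : tsub (@Var L) t = t.
Proof.
elim/term_ind_ffun: t => [//|f ts IH] /=.
by congr App; apply/ffunP => k; rewrite ffunE IH.
Qed.

Lemma upd_Var x : upd (@Var L) x (Var x) = @Var L.
Proof. by apply/funext => y; rewrite /upd; case: eqVneq => [->|]. Qed.

Lemma fsub_id A : fsub (@Var L) A = A.
Proof.
elim: A => [|t u|R ts|B IB C IC|B IB C IC|B IB C IC|x B IB|x B IB] //=.
- by rewrite !tsub_id.
- by congr Rel; apply/ffunP => k; rewrite ffunE tsub_id.
- by rewrite IB IC.
- by rewrite IB IC.
- by rewrite IB IC.
- by rewrite upd_Var IB.
- by rewrite upd_Var IB.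
Qed.

Lemma fsub_closed s A : fv A = [::] -> fsub s A = A.
Proof. by move=> A0; rewrite -[RHS]fsub_id; apply: eq_fsub; rewrite A0. Qed.

Lemma term_substE x t u : term_subst x t u = tsub (upd (@Var L) x t) u.
Proof.
elim/term_ind_ffun: u => [//|f ts IH] /=.
by congr App; apply/ffunP => k; rewrite !ffunE IH.
Qed.

Lemma term_subst_notin x t u : x \notin term_fv u -> term_subst x t u = u.
Proof.
move=> xu; rewrite term_substE -[RHS]tsub_id; apply: eq_tsub => y yu.
by apply: upd_other; apply: contraNneq xu => <-.
Qed.

Lemma term_subst_id x u : term_subst x (Var x) u = u.
Proof. by rewrite term_substE upd_Var tsub_id. Qed.

Lemma subst_notin x t A : x \notin fv A -> subst x t A = A.
Proof.
elim: A => [|u v|R ts|B IB C IC|B IB C IC|B IB C IC|y B IB|y B IB] //=.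
- by rewrite mem_cat negb_or => /andP[xu xv]; rewrite !term_subst_notin.
- move=> xR; congr Rel; apply/ffunP => k; rewrite ffunE term_subst_notin //.
  by apply: contra xR => xk; apply/mem_flatten_ordP; exists k.
- by rewrite mem_cat negb_or => /andP[/IB-> /IC->].
- by rewrite mem_cat negb_or => /andP[/IB-> /IC->].
- by rewrite mem_cat negb_or => /andP[/IB-> /IC->].
- by rewrite mem_fv_bind eq_sym; case: eqVneq => //= _ /IB->.
- by rewrite mem_fv_bind eq_sym; case: eqVneq => //= _ /IB->.
Qed.

Lemma subst_id x A : subst x (Var x) A = A.
Proof.
elim: A => [|u v|R ts|B IB C IC|B IB C IC|B IB C IC|y B IB|y B IB] //=.
- by rewrite !term_subst_id.
- by congr Rel; apply/ffunP => k; rewrite ffunE term_subst_id.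
- by rewrite IB IC.
- by rewrite IB IC.
- by rewrite IB IC.
- by rewrite IB if_same.
- by rewrite IB if_same.
Qed.

Lemma free_for_id x A : free_for (Var x) x A.
Proof.
elim: A => [|u v|R ts|B IB C IC|B IB C IC|B IB C IC|y B IB|y B IB] //=;
  rewrite ?IB ?IC // mem_fv_bind inE eq_sym;
  by case: eqVneq => //= _; rewrite ?orbT.
Qed.

(** By hypothesis no other substituted term brings in an occurrence of [x], so the later replacement
    meets only the protected [x]. This identifies an instance of a quantified formula with a
    simultaneous substitution. *)
Lemma subst_fsub s x t A :
  (forall y, y \in fv A -> y != x -> x \notin term_fv (s y)) ->
  subst x t (fsub (upd s x (Var x)) A) = fsub (upd s x t) A.
Proof.
(* Binders update both substitutions, so the induction runs over arbitrary pairs related like the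
   two in the statement. *)
pose agree s1 s2 B := [/\ s1 x = Var x, s2 x = t & forall y, y \in fv B ->
  y != x -> s1 y = s2 y /\ x \notin term_fv (s1 y)].
suff gen s1 s2 : agree s1 s2 A -> subst x t (fsub s1 A) = fsub s2 A.
  move=> xs; apply: gen; split; rewrite ?upd_same // => y yA yx.
  by rewrite !upd_other //; split=> //; apply: xs.
have tgen r1 r2 u : r1 x = Var x -> r2 x = t ->
    (forall y, y \in term_fv u -> y != x -> r1 y = r2 y /\ x \notin term_fv (r1 y)) ->
    term_subst x t (tsub r1 u) = tsub r2 u.
  move=> r1x r2x; elim/term_ind_ffun: u => [y|f ts IH] /= h.
    have [->|yx] := eqVneq y x; first by rewrite r1x r2x /= eqxx.
    by have [|<- xr] := h y _ yx; rewrite ?inE // term_subst_notin.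
  congr App; apply/ffunP => k; rewrite !ffunE; apply: IH => y yk.
  by apply: h; apply/mem_flatten_ordP; exists k.
(* Below a binder of [x] itself the substitution stops and both sides already coincide; below any
   other binder the relation is kept. *)
have bind r1 r2 y B : agree r1 r2 (All y B) ->
    (if y == x then fsub (upd r1 y (Var y)) B
     else subst x t (fsub (upd r1 y (Var y)) B)) = fsub (upd r2 y (Var y)) B \/
    y != x /\ agree (upd r1 y (Var y)) (upd r2 y (Var y)) B.
  move=> [r1x r2x h]; case: eqVneq => [yx|yx]; [left|right; split=> //].
    apply: eq_fsub; apply: eq_upd => z zB.
    by have [//|] := h z zB; move: zB; rewrite mem_fv_bind yx => /andP[].
  split; rewrite ?upd_other // 1?eq_sym // => z zB zx.
  rewrite /upd; case: eqVneq => [_|zy]; last by apply: h; rewrite //= mem_fv_bind zy.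
  by rewrite /= inE eq_sym.
elim: A s1 s2 => [|u v|R ts|B IB C IC|B IB C IC|B IB C IC|y B IB|y B IB] s1 s2 //= h.
- case: h => r1x r2x h.
  by congr Eq; apply: tgen => // y yu; apply: h; rewrite /= mem_cat yu ?orbT.
- case: h => r1x r2x h; congr Rel; apply/ffunP => k; rewrite !ffunE.
  by apply: tgen => // y yk; apply: h; apply/mem_flatten_ordP; exists k.
- case: h => r1x r2x h.
  by congr And; [apply: IB|apply: IC]; split=> // y yu; apply: h; rewrite /= mem_cat yu ?orbT.
- case: h => r1x r2x h.
  by congr Or; [apply: IB|apply: IC]; split=> // y yu; apply: h; rewrite /= mem_cat yu ?orbT.
- case: h => r1x r2x h.
  by congr Imp; [apply: IB|apply: IC]; split=> // y yu; apply: h; rewrite /= mem_cat yu ?orbT.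
- by case: (bind _ _ _ _ h) => [-> //|[/negbTE-> /IB->]].
- by case: (bind _ _ _ _ h) => [-> //|[/negbTE-> /IB->]].
Qed.

(** [A] may bind [x]: below such a binder the first substitution stops, so [z] is not free there and
    putting [x] back is never captured. Freshness of [z] for the binders of [A] protects the first
    substitution. *)
Lemma subst_renameK x z A : z != x -> z \notin fv A -> z \notin bv A ->
  subst z (Var x) (subst x (Var z) A) = A /\
  free_for (Var x) z (subst x (Var z) A).
Proof.
move=> zx.
have tK u : z \notin term_fv u -> term_subst z (Var x) (term_subst x (Var z) u) = u.
  elim/term_ind_ffun: u => [y|f ts IH] /=.
    rewrite inE eq_sym => yz; case: eqVneq => [->|yx] /=; first by rewrite eqxx.
    by rewrite (negbTE yz).
  move=> zts; congr App; apply/ffunP => k; rewrite !ffunE; apply: IH.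
  by apply: contra zts => zk; apply/mem_flatten_ordP; exists k.
elim: A => [|u v|R ts|B IB C IC|B IB C IC|B IB C IC|y B IB|y B IB] //=.
- by rewrite mem_cat negb_or => /andP[zu zv] _; rewrite !tK.
- move=> zR _; split=> //; congr Rel; apply/ffunP => k; rewrite !ffunE; apply: tK.
  by apply: contra zR => zk; apply/mem_flatten_ordP; exists k.
- rewrite !mem_cat !negb_or => /andP[zB zC] /andP[bB bC].
  by have [-> ->] := IB zB bB; have [-> ->] := IC zC bC.
- rewrite !mem_cat !negb_or => /andP[zB zC] /andP[bB bC].
  by have [-> ->] := IB zB bB; have [-> ->] := IC zC bC.
- rewrite !mem_cat !negb_or => /andP[zB zC] /andP[bB bC].
  by have [-> ->] := IB zB bB; have [-> ->] := IC zC bC.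
- move=> zB; rewrite inE negb_or => /andP[zy bB].
  rewrite mem_fv_bind zy /= in zB; rewrite eq_sym (negbTE zy).
  case: eqVneq => [yx|yx]; first by rewrite subst_notin // mem_fv_bind (negbTE zB) andbF.
  by have [-> ->] := IB zB bB; rewrite inE yx orbT.
- move=> zB; rewrite inE negb_or => /andP[zy bB].
  rewrite mem_fv_bind zy /= in zB; rewrite eq_sym (negbTE zy).
  case: eqVneq => [yx|yx]; first by rewrite subst_notin // mem_fv_bind (negbTE zB) andbF.
  by have [-> ->] := IB zB bB; rewrite inE yx orbT.
Qed.

Lemma bv_fsub s A : bv (fsub s A) = bv A.
Proof.
by elim: A s => [|u v|R ts|B IB C IC|B IB C IC|B IB C IC|y B IB|y B IB] s //=;
  rewrite ?IB ?IC.
Qed.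

Lemma free_for_bv x t A : {in term_fv t, forall y, y \notin bv A} -> free_for t x A.
Proof.
elim: A => [|u v|R ts|B IB C IC|B IB C IC|B IB C IC|y B IB|y B IB] //= h.
- by rewrite IB ?IC // => y /h; rewrite mem_cat negb_or => /andP[].
- by rewrite IB ?IC // => y /h; rewrite mem_cat negb_or => /andP[].
- by rewrite IB ?IC // => y /h; rewrite mem_cat negb_or => /andP[].
- apply/orP; right; rewrite IB => [|z /h]; last by rewrite inE negb_or => /andP[].
  by rewrite andbT; apply/negP => /h; rewrite mem_head.
- apply/orP; right; rewrite IB => [|z /h]; last by rewrite inE negb_or => /andP[].
  by rewrite andbT; apply/negP => /h; rewrite mem_head.
Qed.

Lemma term_fv_tsub s t z : z \in term_fv (tsub s t) ->
  exists2 y, y \in term_fv t & z \in term_fv (s y).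
Proof.
elim/term_ind_ffun: t => [x|f ts IH] /=; first by exists x; rewrite ?inE.
case/mem_flatten_ordP => k; rewrite ffunE => /IH[y yk zy].
by exists y => //; apply/mem_flatten_ordP; exists k.
Qed.

Lemma fv_fsub s A z : z \in fv (fsub s A) -> exists2 y, y \in fv A & z \in term_fv (s y).
Proof.
have bind x B : (forall r, z \in fv (fsub r B) -> exists2 y, y \in fv B & z \in term_fv (r y)) ->
    forall r, z \in [seq y <- fv (fsub (upd r x (Var x)) B) | y != x] ->
    exists2 y, y \in [seq y <- fv B | y != x] & z \in term_fv (r y).
  move=> IB r; rewrite mem_fv_bind => /andP[zx /IB[y yB]]; rewrite /upd.
  case: eqVneq => [_|yx zy]; first by rewrite /= inE (negbTE zx).
  by exists y; rewrite // mem_fv_bind yx.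
have cat B C r : (z \in fv (fsub r B) -> exists2 y, y \in fv B & z \in term_fv (r y)) ->
    (z \in fv (fsub r C) -> exists2 y, y \in fv C & z \in term_fv (r y)) ->
    z \in fv (fsub r B) ++ fv (fsub r C) ->
    exists2 y, y \in fv B ++ fv C & z \in term_fv (r y).
  by move=> IB IC; rewrite mem_cat => /orP[/IB|/IC] [y yB zy]; exists y;
    rewrite // mem_cat yB ?orbT.
elim: A s => [|u v|R ts|B IB C IC|B IB C IC|B IB C IC|x B IB|x B IB] s //=; auto.
- by rewrite mem_cat => /orP[] /term_fv_tsub [y yu zy]; exists y; rewrite // mem_cat yu ?orbT.
- case/mem_flatten_ordP => k; rewrite ffunE => /term_fv_tsub[y yk zy].
  by exists y => //; apply/mem_flatten_ordP; exists k.
Qed.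

Lemma tsub_sort s t i : (forall x, term_has_sort (s x) (var_sort x)) ->
  term_has_sort t i -> term_has_sort (tsub s t) i.
Proof.
move=> ss; elim=> [x|f ts r j _ IH fr] /=; first exact: ss.
by apply: App_sort fr => k; rewrite ffunE.
Qed.

Lemma upd_sort s x t : (forall y, term_has_sort (s y) (var_sort y)) ->
  term_has_sort t (var_sort x) -> forall y, term_has_sort (upd s x t y) (var_sort y).
Proof. by move=> ss tx y; rewrite /upd; case: eqVneq => [->|]. Qed.

Lemma fsub_well_sorted s A : (forall x, term_has_sort (s x) (var_sort x)) ->
  well_sorted A -> well_sorted (fsub s A).
Proof.
elim: A s => [|u v|R ts|B IB C IC|B IB C IC|B IB C IC|x B IB|x B IB] s //= ss.
- by move=> [i [ui vi]]; exists i; split; apply: tsub_sort.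
- by move=> [r [rts rR]]; exists r; split=> // k; rewrite ffunE; apply: tsub_sort.
- by move=> [wB wC]; split; auto.
- by move=> [wB wC]; split; auto.
- by move=> [wB wC]; split; auto.
- by apply: IB; apply: upd_sort => //; apply: Var_sort.
- by apply: IB; apply: upd_sort => //; apply: Var_sort.
Qed.

End Syntax.

(** * Monotonicity and compactness of natural deduction *)

Section Deduction.
Variables (L : signature) (ok : formula L -> Prop).
Variables (inst : var L -> term L -> Prop) (ax : formula L -> Prop).
Local Notation nd := (nd ok inst ax).

Lemma nd_ok G A : nd G A -> ok A.
Proof. by elim. Qed.

Lemma nd_mono (ok' : formula L -> Prop) (inst' : var L -> term L -> Prop)
    (ax' : formula L -> Prop) G A :
  (forall A, ok A -> ok' A) -> (forall x t, inst x t -> inst' x t) ->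
  (forall A, ax A -> ax' A) -> nd G A -> Defs.nd ok' inst' ax' G A.
Proof.
move=> okk instt axx; elim=> {G A}.
- by move=> G A oA GA; apply: nd_hyp; auto.
- by move=> G A oA aA; apply: nd_ax; auto.
- by move=> G H A GH _ IH; apply: nd_weak IH.
- by move=> G A B oA _ IA _ IB; apply: nd_andI; auto.
- by move=> G A B oA _ IA; apply: nd_andE1 IA; auto.
- by move=> G A B oA _ IA; apply: nd_andE2 IA; auto.
- by move=> G A B oA _ IA; apply: nd_orI1; auto.
- by move=> G A B oA _ IA; apply: nd_orI2; auto.
- by move=> G A B C oA _ IA _ IB _ IC; apply: nd_orE IA IB IC; auto.
- by move=> G A B oA _ IA; apply: nd_impI; auto.
- by move=> G A B oA _ IA _ IB; apply: nd_impE IA IB; auto.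
- by move=> G A oA _ IA; apply: nd_botE; auto.
- by move=> G A oA _ IA; apply: nd_raa; auto.
- by move=> G x A oA xG _ IA; apply: nd_allI; auto.
- by move=> G x t A oA it ft _ IA; apply: nd_allE; auto.
- by move=> G x t A oA it ft _ IA; apply: nd_exI (IA); auto.
- by move=> G x A C oA xG xC _ IA _ IC; apply: nd_exE IA IC; auto.
Qed.

Definition seq_ctx (s : seq (formula L)) : set (formula L) := [set B | List.In B s].

Lemma seq_ctx_sub1 (G : set (formula L)) A s : seq_ctx s `<=` G `|` [set A] ->
  exists2 s', seq_ctx s' `<=` G & seq_ctx s `<=` seq_ctx s' `|` [set A].
Proof.
elim: s => [_|B s IH sG]; first by exists [::] => // ? [].
have [|s' s'G ss'] := IH; first by move=> C Cs; apply: sG; right.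
case: (sG B (or_introl erefl)) => [GB|->].
- exists (B :: s') => [C [<- //|]|C [<-|/ss'[Cs'|CA]]]; first exact: s'G.
  + by left; left.
  + by left; right.
  + by right.
- by exists s' => // C [<-|/ss' //]; right.
Qed.

Lemma seq_ctx_cat s1 s2 (G : set (formula L)) :
  seq_ctx s1 `<=` G -> seq_ctx s2 `<=` G -> seq_ctx (s1 ++ s2) `<=` G.
Proof. by move=> s1G s2G C /(List.in_app_or s1 s2)[/s1G|/s2G]. Qed.

Lemma seq_ctx_catl s1 s2 : seq_ctx s1 `<=` seq_ctx (s1 ++ s2).
Proof. by move=> C Cs; apply: List.in_or_app; left. Qed.

Lemma seq_ctx_catr s1 s2 : seq_ctx s2 `<=` seq_ctx (s1 ++ s2).
Proof. by move=> C Cs; apply: List.in_or_app; right. Qed.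

Let setU1S (G H : set (formula L)) A : G `<=` H -> G `|` [set A] `<=` H `|` [set A].
Proof. by move=> GH; apply: setSU. Qed.

(** Finite contexts of the premises are concatenated, and eigenvariable conditions pass to smaller
    contexts. Finiteness is what allows all assumptions to be discharged into one formula. *)
Lemma nd_compact G A : nd G A -> exists2 s, seq_ctx s `<=` G & nd (seq_ctx s) A.
Proof.
have wl s1 s2 B : nd (seq_ctx s1) B -> nd (seq_ctx (s1 ++ s2)) B.
  exact: nd_weak (@seq_ctx_catl _ _).
have wr s1 s2 B : nd (seq_ctx s2) B -> nd (seq_ctx (s1 ++ s2)) B.
  exact: nd_weak (@seq_ctx_catr _ _).
have ext H A' B : (exists2 s, seq_ctx s `<=` H `|` [set A'] & nd (seq_ctx s) B) ->
    exists2 s, seq_ctx s `<=` H & nd (seq_ctx s `|` [set A']) B.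
  by case=> s /seq_ctx_sub1[s' s'H ss'] sB; exists s' => //; apply: nd_weak sB.
elim=> {G A}.
- move=> G A oA GA; exists [:: A] => [B [<-|[]] //|].
  by apply: nd_hyp => //; left.
- by move=> G A oA aA; exists [::] => [B []|]; apply: nd_ax.
- by move=> G H A GH _ [s sG sA]; exists s => // B /sG /GH.
- move=> G A B oA _ [s sG sA] _ [r rG rB]; exists (s ++ r); first exact: seq_ctx_cat.
  by apply: nd_andI; auto.
- by move=> G A B oA _ [s sG sA]; exists s => //; apply: nd_andE1 sA.
- by move=> G A B oA _ [s sG sA]; exists s => //; apply: nd_andE2 sA.
- by move=> G A B oA _ [s sG sA]; exists s => //; apply: nd_orI1.
- by move=> G A B oA _ [s sG sA]; exists s => //; apply: nd_orI2.
- move=> G A B C oC _ [s sG sAB] _ /ext[r rG rC] _ /ext[q qG qC].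
  exists (s ++ (r ++ q)); first by do 2?apply: seq_ctx_cat.
  apply: (nd_orE oC (wl _ _ _ sAB)).
  + by apply: nd_weak rC; apply: setU1S => D Dr; apply/seq_ctx_catr/seq_ctx_catl.
  + by apply: nd_weak qC; apply: setU1S => D Dr; apply/seq_ctx_catr/seq_ctx_catr.
- by move=> G A B oA _ /ext[s sG sB]; exists s => //; apply: nd_impI.
- move=> G A B oA _ [s sG sA] _ [r rG rB]; exists (s ++ r); first exact: seq_ctx_cat.
  by apply: (nd_impE oA (wl _ _ _ sA)); auto.
- by move=> G A oA _ [s sG sA]; exists s => //; apply: nd_botE.
- by move=> G A oA _ /ext[s sG sA]; exists s => //; apply: nd_raa.
- by move=> G x A oA xG _ [s sG sA]; exists s => //; apply: nd_allI => // B /sG; auto.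
- by move=> G x t A oA it ft _ [s sG sA]; exists s => //; apply: nd_allE.
- by move=> G x t A oA it ft _ [s sG sA]; exists s => //; apply: nd_exI sA.
- move=> G x A C oC xG xC _ [s sG sA] _ /ext[r rG rC].
  have srG := seq_ctx_cat sG rG; exists (s ++ r) => //.
  apply: (nd_exE oC _ xC (wl _ _ _ sA)) => [B /srG|]; first exact: xG.
  by apply: nd_weak rC; apply: setU1S; apply: seq_ctx_catr.
Qed.

End Deduction.

(** * Points, evaluation of terms and the forcing relation *)

Section Forcing.
Variables (L : signature) (X : seq (var L)).
Implicit Types (x y z : var L) (t u : term L) (A B C : formula L).
Implicit Types (G D : set (formula L)) (P Q : set (formula L) -> Prop).

(** Chosen from the rank; strictness makes it the only possible tuple. *)
Definition rel_sorts (R : relsym L) : {ffun 'I_(rel_arity R) -> sorts L} :=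
  sval (cid (rel_rank_nonempty R)).

Definition fun_sorts (f : funsym L) : {ffun 'I_(fun_arity f) -> sorts L} :=
  sval (cid (fun_rank_nonempty f)).

(** [X] will hold the bound variables of the sentence under study, so that substituting such terms
    into its subformulas captures nothing. *)
Definition pure_term (i : sorts L) t : Prop :=
  term_has_sort t i /\ {in term_fv t, forall y, y \notin X}.

Definition default_term (i : sorts L) : term L := Var (s2val (cid2 (fresh_var X i))).

Lemma pure_Var z : z \notin X -> pure_term z.1 (Var z).
Proof. by move=> zX; split=> [|y /=]; [exact: Var_sort|rewrite inE => /eqP->]. Qed.

Lemma pure_default i : pure_term i (default_term i).
Proof. by rewrite /default_term; case: cid2 => z zX /= <-; apply: pure_Var. Qed.

(* The elements of the product of all sorts, to which unsorted variables range. *)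
Definition point := sorts L -> term L.

Definition pure_point (d : point) : Prop := forall i, pure_term i (d i).

Definition pure_env (r : var L -> point) : Prop := forall x, pure_point (r x).

Lemma pure_upd r x d : pure_env r -> pure_point d -> pure_env (upd r x d).
Proof. by move=> rp dp y; rewrite /upd; case: eqVneq. Qed.

(** Surjectivity of the projection to sort [i]: the remaining components are filled with default
    variables. *)
Lemma pure_point_at i t : pure_term i t ->
  exists2 d : point, pure_point d & d i = t.
Proof.
move=> it; exists (upd default_term i t); last exact: upd_same.
by move=> j; rewrite /upd; case: eqVneq => [->|_]; [|exact: pure_default].
Qed.

(** [f] reads each argument at the sort it expects and yields a genuine component only at its value
    sort; the default elsewhere makes the result a point even for ill-sorted terms. *)
Fixpoint eval (r : var L -> point) t : point :=
  match t with
  | Var x => r x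
  | App f ts => fun i =>
      if `[< fun_rank (fun_sorts f) i >]
      then App [ffun k => eval r (ts k) (fun_sorts f k)]
      else default_term i
  end.

Lemma pure_eval r t : pure_env r -> pure_point (eval r t).
Proof.
move=> rp; elim/term_ind_ffun: t => [x|f ts IH] i /=; first exact: rp.
case: asboolP => [fi|_]; last exact: pure_default.
split=> [|y /=]; first by apply: App_sort fi => k; rewrite ffunE; have [] := IH k (fun_sorts f k).
by case/mem_flatten_ordP => k; rewrite ffunE; have [_] := IH k (fun_sorts f k); apply.
Qed.

Lemma eq_eval r r' t : {in term_fv t, r =1 r'} -> eval r t = eval r' t.
Proof.
elim/term_ind_ffun: t => [x|f ts IH] /= rr'; first by apply: rr'; rewrite inE.
apply/funext => i; case: ifP => // _; congr App; apply/ffunP => k; rewrite !ffunE.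
by rewrite IH // => x xk; apply: rr'; apply/mem_flatten_ordP; exists k.
Qed.

Lemma eval_subst r x t u : eval r (term_subst x t u) = eval (upd r x (eval r t)) u.
Proof.
elim/term_ind_ffun: u => [y|f ts IH] /=; first by rewrite /upd; case: eqVneq.
apply/funext => i; case: ifP => // _; congr App; apply/ffunP => k; rewrite !ffunE.
by rewrite IH.
Qed.

Definition env_subst (r : var L -> point) : var L -> term L := fun x => r x (var_sort x).

Lemma env_subst_upd r x d : env_subst (upd r x d) = upd (env_subst r) x (d (var_sort x)).
Proof. by apply/funext => y; rewrite /env_subst /upd; case: eqVneq => [->|]. Qed.

(** Strictness identifies the argument sorts of the sorting derivation with those used by [eval]. *)
Lemma eval_sorted r t i : (forall f : funsym L, strict_fun f) ->
  term_has_sort t i -> eval r t i = tsub (env_subst r) t.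
Proof.
move=> strictF; elim=> [//|f ts s j _ IH fr] /=.
have [s0 [_ s0u]] := strictF f; have se : fun_sorts f = s.
  rewrite -(s0u s); last by exists j.
  by rewrite /fun_sorts; case: cid => s' [j' fr'] /=; rewrite -(s0u s') //; exists j'.
rewrite se; case: asboolP => // _; congr App; apply/ffunP => k; rewrite !ffunE.
exact: IH.
Qed.

(** Free variables stay out of [X], so each member of [X] can serve as an eigenvariable; the finite
    bound [vs], even for an infinite context, leaves fresh variables in every sort. *)
Definition world G : Prop :=
  (forall B, G B -> well_sorted B /\ {in fv B, forall x, x \notin X}) /\
  exists vs : seq (var L), forall B, G B -> {subset fv B <= vs}.

Lemma world_add G A : world G -> well_sorted A -> {in fv A, forall x, x \notin X} ->
  world (G `|` [set A]).
Proof.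
move=> [GX [vs Gvs]] wA AX; split=> [B [/GX //|->] //|].
by exists (fv A ++ vs) => B [/Gvs Bvs|->] x xB; rewrite mem_cat ?xB // Bvs ?orbT.
Qed.

(** Kripke negation over extending worlds, with inconsistency of the context in the role of
    falsity. *)
Definition neg P G : Prop :=
  forall D, G `<=` D -> world D -> P D -> msl_derives D Bot.

Definition meet_points (F : point -> set (formula L) -> Prop) G : Prop :=
  forall d, pure_point d -> F d G.

(** A negative translation inside Kripke semantics. Inconsistency counts as a reason for an equation
    so that an inconsistent world forces every formula. *)
Fixpoint force (r : var L -> point) A : set (formula L) -> Prop :=
  match A with
  | Bot => fun G => msl_derives G Bot
  | Eq t u => fun G => msl_derives G Bot \/ eval r t = eval r u
  | Rel R ts => fun G => msl_derives G (Rel [ffun k => eval r (ts k) (rel_sorts R k)])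
  | And B C => fun G => force r B G /\ force r C G
  | Or B C => neg (fun G => neg (force r B) G /\ neg (force r C) G)
  | Imp B C => fun G =>
      forall D, G `<=` D -> world D -> force r B D -> force r C D
  | Ex x B => neg (meet_points (fun d => neg (force (upd r x d) B)))
  | All x B => meet_points (fun d => force (upd r x d) B)
  end.

(** Equality of predicates, rather than equivalence at one context, allows rewriting under [neg] and
    [meet_points]. *)
Lemma eq_force r r' A : {in fv A, r =1 r'} -> force r A = force r' A.
Proof.
elim: A r r' => [|t u|R ts|B IB C IC|B IB C IC|B IB C IC|x B IB|x B IB] r r' //= rr'.
- by rewrite !(@eq_eval r r') // => x xt; apply: rr'; rewrite mem_cat xt ?orbT.
- apply/funext => G; congr msl_derives; congr Rel; apply/ffunP => k; rewrite !ffunE.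
  by rewrite (@eq_eval r r') // => x xk; apply: rr'; apply/mem_flatten_ordP; exists k.
- by rewrite (IB r r') 1?(IC r r') // => x xB; apply: rr'; rewrite mem_cat xB ?orbT.
- by rewrite (IB r r') 1?(IC r r') // => x xB; apply: rr'; rewrite mem_cat xB ?orbT.
- by rewrite (IB r r') 1?(IC r r') // => x xB; apply: rr'; rewrite mem_cat xB ?orbT.
- by congr (neg (meet_points _)); apply/funext => d; congr neg; apply/IB/eq_upd.
- by congr meet_points; apply/funext => d; apply/IB/eq_upd.
Qed.

(** Freeness of [t] ensures that updating a variable bound on the way does not change the value of
    [t]. *)
Lemma force_subst r x t A : free_for t x A ->
  force r (subst x t A) = force (upd r x (eval r t)) A.
Proof.
have bind y B r0 d : (forall r, free_for t x B ->
      force r (subst x t B) = force (upd r x (eval r t)) B) ->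
    (x \notin fv (All y B)) || (y \notin term_fv t) && free_for t x B ->
    force (upd r0 y d) (if y == x then B else subst x t B) =
    force (upd (upd r0 x (eval r0 t)) y d) B.
  move=> IB; rewrite mem_fv_bind; case: eqVneq => [-> _|yx].
    by apply: eq_force => z _; rewrite /upd; case: eqVneq.
  rewrite /=; case/orP => [xB|/andP[yt ft]].
    rewrite subst_notin //; apply: eq_force => z zB; rewrite /upd.
    case: eqVneq => // _; case: eqVneq => // zx; by rewrite -zx zB in xB.
  rewrite IB // (@eq_eval (upd r0 y d) r0) => [|z zt].
    apply: eq_force => z _; rewrite /upd; case: eqVneq => // ->.
    by rewrite (negbTE yx).
  by apply: upd_other; apply: contraNneq yt => <-.
elim: A r => [|u v|R ts|B IB C IC|B IB C IC|B IB C IC|y B IB|y B IB] r //=.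
- by rewrite !eval_subst.
- move=> _; apply/funext => G; congr msl_derives; congr Rel; apply/ffunP => k.
  by rewrite !ffunE eval_subst.
- by move=> /andP[/IB-> /IC->].
- by move=> /andP[/IB-> /IC->].
- by move=> /andP[/IB-> /IC->].
- move=> ft; congr (neg (meet_points _)); apply/funext => d; congr neg.
  exact: bind.
- by move=> ft; congr meet_points; apply/funext => d; apply: bind.
Qed.

Lemma neg_mono P G D : G `<=` D -> neg P G -> neg P D.
Proof. by move=> GD nP E DE; apply: nP; apply: subset_trans DE. Qed.

Lemma force_mono r A G D : G `<=` D -> world D -> force r A G -> force r A D.
Proof.
elim: A r G D => [|t u|R ts|B IB C IC|B IB C IC|B IB C IC|x B IB|x B IB] r G D /= GD wD.
- exact: nd_weak.
- by case=> [G0|->]; [left; apply: nd_weak G0|right].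
- exact: nd_weak.
- by move=> [gB gC]; split; [apply: IB gB|apply: IC gC].
- exact: neg_mono.
- by move=> gBC E DE; apply: gBC; apply: subset_trans DE.
- exact: neg_mono.
- by move=> gB d dp; apply: IB (gB d dp).
Qed.

Lemma negnegI P G : (forall D, G `<=` D -> world D -> P G -> P D) ->
  P G -> neg (neg P) G.
Proof. by move=> mP PG D GD wD; apply; auto. Qed.

Lemma neg_stable P G : world G -> (forall G D, G `<=` D -> world D -> P G -> P D) ->
  neg (neg (neg P)) G -> neg P G.
Proof.
move=> wG mP nnn D GD wD PD; apply: nnn => //.
by apply: negnegI => // E DE wE; apply: mP.
Qed.

(** Classical reasoning enters here: relational atoms are stable by reductio in the calculus,
    equations by excluded middle about points, and [Or] and [Ex] are already negations. *)
Lemma force_stable r A G : pure_env r -> world G ->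
  neg (neg (force r A)) G -> force r A G.
Proof.
elim: A r G => [|t u|R ts|B IB C IC|B IB C IC|B IB C IC|x B IB|x B IB] r G rp wG /= nn.
- by apply: nn.
- have [|tu] := pselect (eval r t = eval r u); first by right.
  by left; apply: nn => // D GD wD [].
- have wsR : well_sorted (Rel [ffun k => eval r (ts k) (rel_sorts R k)]).
    exists (rel_sorts R); split; last by rewrite /rel_sorts; case: cid.
    by move=> k; rewrite ffunE; have [] := pure_eval (ts k) rp (rel_sorts R k).
  (* The context extended by the negated atom refutes the atom in all further extensions, hence is
     inconsistent by the double negation. *)
  apply: nd_raa => //; apply: nn => //.
    apply: world_add => // x /=; rewrite cats0; case/mem_flatten_ordP => k.
    by rewrite ffunE; have [_] := pure_eval (ts k) rp (rel_sorts R k); apply.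
  move=> D GD wD RD; apply: nd_impE RD => //.
  by apply: nd_hyp => //; apply: GD; right.
- split; [apply: IB|apply: IC] => // D GD wD nB; apply: nn => // E DE wE [gB gC].
    by apply: nB.
  by apply: nB.
- apply: neg_stable nn => // G1 D GD wD [nB nC].
  by split; apply: neg_mono GD _.
- move=> D GD wD gB; apply: IC => // E DE wE nC; apply: nn => //.
    exact: subset_trans DE.
  move=> F EF wF gBC; apply: nC => //; apply: gBC => //.
  apply: force_mono gB => //; exact: subset_trans EF.
- apply: neg_stable nn => // G1 D GD wD nB d dp.
  by apply: neg_mono GD _; apply: nB.
- move=> d dp; apply: IB => //; first exact: pure_upd.
  by move=> D GD wD nB; apply: nn => // E DE wE gB; apply: nB => //; apply: gB.
Qed.

Lemma force_absurd r A G : pure_env r -> world G -> msl_derives G Bot -> force r A G.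
Proof. by move=> rp wG G0; apply: force_stable => // D GD _ _; apply: nd_weak G0. Qed.

(** * Soundness of unsorted logic for forcing *)

Lemma force_closure A G : (forall r, pure_env r -> force r A G) ->
  forall r, pure_env r -> force r (universal_closure A) G.
Proof.
move=> gA; rewrite /universal_closure; elim: undup => [//|x xs IH] r rp d dp /=.
by apply: IH; apply: pure_upd.
Qed.

Lemma force_conj_seq r As G : force r (conj_seq As) G ->
  forall A, List.In A As -> force r A G.
Proof.
elim: As => [//|B [|C Cs] IH] /=; first by move=> gB A [<-|[]].
by move=> [gB gCs] A [<- //|ACs]; apply: IH.
Qed.

(** Inconsistency is decided first; in a consistent context every conjunct then yields a true
    equality of points. *)
Lemma force_eq_vars r n (x y : {ffun 'I_n -> var L}) G :
  force r (eq_vars x y) G -> msl_derives G Bot \/ forall k, r (x k) = r (y k).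
Proof.
move/force_conj_seq => gxy; have [|nG] := pselect (msl_derives G Bot); first by left.
right=> k; have [|//|//] := gxy (eq_var (x k) (y k)).
apply: (List.in_map (fun k => eq_var (x k) (y k))).
have : k \in enum 'I_n by rewrite mem_enum.
by elim: (enum 'I_n) => //= j js IH; rewrite inE => /predU1P[->|/IH]; auto.
Qed.

(** Outside inconsistent contexts equality is identity of points, so congruence holds whatever the
    sorts of the variables. *)
Lemma force_fol_eq_axiom A r G : fol_eq_axiom A -> pure_env r -> world G -> force r A G.
Proof.
move=> axA + wG; case: axA => [x|x y|x y z|R x y|f x y]; apply: force_closure => {}r rp.
- by right.
- by move=> D GD wD /= [D0|->]; [left|right].
- by move=> D GD wD /= [[D0|xy] [D0'|yz]]; [left|left|left|right; rewrite xy].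
- move=> D GD wD /force_eq_vars[D0|xy] E DE wE; first last.
    have xyE : force r (Rel [ffun k => Var (x k)]) = force r (Rel [ffun k => Var (y k)]).
      apply/funext => F /=; congr msl_derives; congr Rel; apply/ffunP => k.
      by rewrite !ffunE /= xy.
    by move=> Rx; have : force r (Rel [ffun k => Var (x k)]) E by []; rewrite xyE.
  by move=> _; apply: (@force_absurd r (Rel [ffun k => Var (y k)])) => //; apply: nd_weak D0.
- move=> D GD wD /force_eq_vars[D0|xy]; [by left|right] => /=.
  apply/funext => i; case: ifP => // _; congr App; apply/ffunP => k.
  by rewrite !ffunE /= xy.
Qed.

(** Every term, well-sorted or not, evaluates to a point, hence unsorted instantiation is sound. The
    rules [nd_orE], [nd_raa] and [nd_exE] reach their conclusion through [force_stable]. *)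
Lemma fol_sound H A : fol_derives H A -> forall r G, pure_env r -> world G ->
  (forall B, H B -> force r B G) -> force r A G.
Proof.
have add r G K B D : (forall B, K B -> force r B G) -> G `<=` D -> world D ->
    force r B D -> forall C, (K `|` [set B]) C -> force r C D.
  by move=> KG GD wD gB C [/KG gC|-> //]; apply: force_mono gC.
(* This is the use of the eigenvariable condition: the assumptions do not depend on the value of
   [x]. *)
have fresh r x d K G : (forall B, K B -> x \notin fv B) ->
    (forall B, K B -> force r B G) -> forall B, K B -> force (upd r x d) B G.
  move=> xK KG B KB; rewrite (@eq_force _ r) => [|y yB]; first exact: KG.
  by apply: upd_other; apply: contraNneq (xK B KB) => <-.
elim=> {H A}.
- by move=> H A _ HA r G rp wG; apply.
- by move=> H A _ axA r G rp wG _; apply: force_fol_eq_axiom.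
- by move=> H K A HK _ IH r G rp wG gK; apply: IH => // B /HK/gK.
- by move=> H A B _ _ IA _ IB r G rp wG gH; split; auto.
- by move=> H A B _ _ IA r G rp wG gH; case: (IA r G rp wG gH).
- by move=> H A B _ _ IA r G rp wG gH; case: (IA r G rp wG gH).
- by move=> H A B _ _ IA r G rp wG gH D GD wD [nA _]; apply: nA => //;
    apply: force_mono (IA r G rp wG gH).
- by move=> H A B _ _ IA r G rp wG gH D GD wD [_ nA]; apply: nA => //;
    apply: force_mono (IA r G rp wG gH).
- move=> H A B C _ _ IAB _ IA _ IB r G rp wG gH; apply: force_stable => // D GD wD nC.
  apply: (IAB r G) => //; split=> E DE wE gE; apply: nC => //; [apply: IA|apply: IB] => //;
    exact: add gH (subset_trans GD DE) wE gE.
- move=> H A B _ _ IB r G rp wG gH D GD wD gA; apply: IB => //.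
  exact: add gH GD wD gA.
- by move=> H A B _ _ IAB _ IA r G rp wG gH; apply: (IAB r G) => //; apply: IA.
- by move=> H A _ _ IA r G rp wG gH; apply: force_absurd => //; apply: (IA r G).
- move=> H A _ _ IA r G rp wG gH; apply: force_stable => // D GD wD nA.
  have nA' : force r (Neg A) D by [].
  by apply: (IA r D) => //; exact: add gH GD wD nA'.
- move=> H x A _ xH _ IA r G rp wG gH d dp; apply: IA => //; first exact: pure_upd.
  exact: fresh.
- move=> H x t A _ _ ft _ IA r G rp wG gH; rewrite force_subst //.
  by apply: (IA r G) => //; apply: pure_eval.
- move=> H x t A _ _ ft _ IA r G rp wG gH D GD wD nA.
  apply: (nA (eval r t)) => //; first exact: pure_eval.
  by have := force_mono GD wD (IA r G rp wG gH); rewrite force_subst.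
- move=> H x A C _ xH xC _ IA _ IC r G rp wG gH; apply: force_stable => // D GD wD nC.
  apply: (IA r G) => // d dp E DE wE gA; apply: nC => //.
  rewrite -(@eq_force (upd r x d)) => [|y yC]; last first.
    by apply: upd_other; apply: contraNneq xC => <-.
  apply: IC => //; first exact: pure_upd.
  exact: add (fresh _ _ _ _ _ xH gH) (subset_trans GD DE) wE gA.
Qed.

(* [x] may be bound again inside [A], so generalization goes through the
   variable [z] and a renaming back to [x]. *)
Lemma msl_gen_fresh G x z A : x \in X -> world G -> well_sorted A ->
  (forall B, G B -> z \notin fv B) -> z \notin x :: fv A ++ bv A ->
  var_sort z = var_sort x ->
  msl_derives G (subst x (Var z) A) -> msl_derives G (All x A).
Proof.
move=> xX [GX _] wA zG; rewrite inE mem_cat !negb_or => /and3P[zx zA zbA] zs GA.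
have [AE ff] := subst_renameK zx zA zbA.
apply: nd_allI => // [B /GX[_ BX]|]; first by apply/negP => /BX; rewrite xX.
rewrite -AE; apply: nd_allE => //; first by rewrite AE.
  by rewrite zs; apply: Var_sort.
by apply: nd_allI => //; apply: nd_ok GA.
Qed.

(** * Agreement of forcing with many-sorted derivability *)

Lemma fresh_for_world G x A : world G -> exists z, [/\ z \notin X,
  forall B, G B -> z \notin fv B, z \notin x :: fv A ++ bv A & var_sort z = var_sort x].
Proof.
move=> [_ [vs Gvs]].
set xs := x :: _; have [z] := fresh_var (X ++ vs ++ xs) (var_sort x).
rewrite mem_cat negb_or mem_cat negb_or => /and3P[zX zvs zA] zs; exists z; split=> //.
by move=> B /Gvs Bvs; apply: contra zvs => /Bvs.
Qed.

(** Values of a pure environment avoid [X], hence avoid [x], as [subst_fsub] requires. *)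
Lemma subst_upd_env r x d A : pure_env r -> x \in X ->
  subst x (d (var_sort x)) (fsub (upd (env_subst r) x (Var x)) A) =
  fsub (env_subst (upd r x d)) A.
Proof.
move=> rp xX; rewrite env_subst_upd subst_fsub // => y _ _.
by apply/negP => /(proj2 (rp y (var_sort y))); rewrite xX.
Qed.

Lemma env_subst_sort r x : pure_env r -> term_has_sort (env_subst r x) (var_sort x).
Proof. by move=> rp; have [] := rp x (var_sort x). Qed.

(** For the quantifiers, every pure point supplies a term of the right sort, and conversely a point
    showing a fresh variable at that sort is generic. Equations are excluded: forcing one in a
    consistent context asks for identical points, which provable equality does not give. *)
Lemma force_truth r A G :
  (forall R : relsym L, strict_rel R) -> (forall f : funsym L, strict_fun f) ->
  pure_env r -> world G -> well_sorted A -> eq_free A -> {subset bv A <= X} ->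
  force r A G <-> msl_derives G (fsub (env_subst r) A).
Proof.
move=> strictR strictF.
have wsub s B : pure_env s -> well_sorted B -> well_sorted (fsub (env_subst s) B).
  by move=> sp; apply: fsub_well_sorted => y; apply: env_subst_sort.
have fvsub s B : pure_env s -> {in fv (fsub (env_subst s) B), forall y, y \notin X}.
  by move=> sp y /fv_fsub[z _]; apply: (proj2 (sp z (var_sort z))).
elim: A r G => [|t u|R ts|B IB C IC|B IB C IC|B IB C IC|x B IB|x B IB] r G rp wG //.
- move=> /= [s [ss sR]] _ _.
  (* By strictness the chosen tuple is the one that sorts the arguments. *)
  have se : rel_sorts R = s.
    have [s0 [_ s0u]] := strictR R; rewrite -(s0u s) //.
    by rewrite /rel_sorts; case: cid => s' sR' /=; rewrite -(s0u s').
  rewrite se (_ : [ffun k => eval _ _ _] = [ffun k => tsub (env_subst r) (ts k)]) //.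
  by apply/ffunP => k; rewrite !ffunE eval_sorted.
- move=> /= [wB wC] /andP[eB eC] bX.
  have bB : {subset bv B <= X} by move=> y yB; apply: bX; rewrite mem_cat yB.
  have bC : {subset bv C <= X} by move=> y yB; apply: bX; rewrite mem_cat yB orbT.
  have wB' := wsub r B rp wB; have wC' := wsub r C rp wC.
  split=> [[gB gC]|gBC]; first by apply: nd_andI => //; [apply/IB|apply/IC].
  split; [apply/IB => //; exact: nd_andE1 wB' gBC|].
  by apply/IC => //; exact: nd_andE2 wC' gBC.
- move=> /= [wB wC] /andP[eB eC] bX.
  have bB : {subset bv B <= X} by move=> y yB; apply: bX; rewrite mem_cat yB.
  have bC : {subset bv C <= X} by move=> y yB; apply: bX; rewrite mem_cat yB orbT.
  have wB' := wsub r B rp wB; have wC' := wsub r C rp wC.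
  set Bs := fsub _ B in wB' *; set Cs := fsub _ C in wC' *.
  split=> [gBC|gBC D GD wD [nB nC]].
    apply: nd_raa => //; apply: gBC => //.
      by apply: world_add => // y; rewrite /= cats0 mem_cat => /orP[] /fvsub; apply.
    split=> D GD wD gD; apply: (@nd_impE _ _ _ _ _ (Or Bs Cs)) => //.
    + by apply: nd_hyp => //; apply: GD; right.
    + by apply: nd_orI1 => //; apply/IB.
    + by apply: nd_hyp => //; apply: GD; right.
    + by apply: nd_orI2 => //; apply/IC.
  have wDB : world (D `|` [set Bs]) by apply: world_add => // y; apply: fvsub.
  have wDC : world (D `|` [set Cs]) by apply: world_add => // y; apply: fvsub.
  apply: (@nd_orE _ _ _ _ _ Bs Cs) => //; first exact: nd_weak gBC.
  + by apply: nB => //; apply/IB => //; apply: nd_hyp => //; right.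
  + by apply: nC => //; apply/IC => //; apply: nd_hyp => //; right.
- move=> /= [wB wC] /andP[eB eC] bX.
  have bB : {subset bv B <= X} by move=> y yB; apply: bX; rewrite mem_cat yB.
  have bC : {subset bv C <= X} by move=> y yB; apply: bX; rewrite mem_cat yB orbT.
  have wB' := wsub r B rp wB; have wC' := wsub r C rp wC.
  split=> [gBC|gBC D GD wD /(IB _ _ rp wD wB eB bB) gB].
    have wGB : world (G `|` [set fsub (env_subst r) B]).
      by apply: world_add => // y; apply: fvsub.
    apply: nd_impI => //; apply/IC => //; apply: gBC => //.
    by apply/IB => //; apply: nd_hyp => //; right.
  apply/IC => //; apply: (@nd_impE _ _ _ _ _ (fsub (env_subst r) B)) => //.
  exact: nd_weak gBC.
- move=> /= wB eB bX; have xX : x \in X by apply: bX; rewrite mem_head.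
  have bB : {subset bv B <= X} by move=> y yB; apply: bX; rewrite inE yB orbT.
  set B' := fsub _ B; have wB' : well_sorted B'.
    apply: fsub_well_sorted => //; apply: upd_sort; last exact: Var_sort.
    by move=> y; apply: env_subst_sort.
  split=> [gB|gB D GD wD nB].
    apply: nd_raa => //; apply: gB => //.
      by apply: world_add => // y; rewrite /= cats0; apply: (fvsub r (Ex x B)).
    move=> d dp D GD wD /(IB _ _ (pure_upd x rp dp) wD wB eB bB) gB; apply: (@nd_impE _ _ _ _ _ (Ex x B')) => //.
      by apply: nd_hyp => //; apply: GD; right.
    apply: (@nd_exI _ _ _ _ _ _ (d (var_sort x))) => //.
    + by have [] := dp (var_sort x).
    + apply: free_for_bv => y /(proj2 (dp (var_sort x))); rewrite bv_fsub.
      exact: contra (bB y).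
    + by rewrite subst_upd_env.
  (* A generic witness: a point whose component at the sort of [x] is a fresh variable. Refuting
     this one instance gives the universal negation by generalization. *)
  have [z [zX zD zB zs]] := fresh_for_world x (Neg B') wD.
  have [d dp dz] : exists2 d, pure_point d & d (var_sort x) = Var z.
    by apply: pure_point_at; rewrite -zs; apply: pure_Var.
  have rdp := pure_upd x rp dp.
  have subE : subst x (Var z) B' = fsub (env_subst (upd r x d)) B.
    by rewrite -dz subst_upd_env.
  have allN : msl_derives D (All x (Neg B')).
    apply: (@msl_gen_fresh _ _ z) => //=; rewrite subE.
    have ws := wsub _ _ rdp wB; have wDB : world (D `|` [set fsub (env_subst (upd r x d)) B]).
      by apply: world_add => // y; apply: fvsub.
    apply: nd_impI => //; apply: (nB d) => //.
    by apply/IB => //; apply: nd_hyp => //; right.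
  have xD C : D C -> x \notin fv C.
    by case: wD => /(_ C) + _ DC => /(_ DC)[_ CX]; apply/negP => /CX; rewrite xX.
  apply: (@nd_exE _ _ _ _ _ x B') => //; first exact: nd_weak gB.
  apply: (@nd_impE _ _ _ _ _ B') => //; last by apply: nd_hyp => //; right.
  have := @nd_allE _ _ _ _ (D `|` [set B']) x (Var x) (Neg B').
  rewrite subst_id; apply=> //; [exact: Var_sort|exact: free_for_id|].
  exact: nd_weak allN.
- move=> /= wB eB bX; have xX : x \in X by apply: bX; rewrite mem_head.
  have bB : {subset bv B <= X} by move=> y yB; apply: bX; rewrite inE yB orbT.
  set B' := fsub _ B; have wB' : well_sorted B'.
    apply: fsub_well_sorted => //; apply: upd_sort; last exact: Var_sort.
    by move=> y; apply: env_subst_sort.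
  split=> [gB|gB d dp].
    (* The instance at a point showing a fresh variable is generalized back to [x]. *)
    have [z [zX zG zB zs]] := fresh_for_world x B' wG.
    have [d dp dz] : exists2 d, pure_point d & d (var_sort x) = Var z.
      by apply: pure_point_at; rewrite -zs; apply: pure_Var.
    have rdp := pure_upd x rp dp.
    apply: (@msl_gen_fresh _ _ z) => //.
    by rewrite -dz subst_upd_env //; apply/IB => //; apply: gB.
  have rdp := pure_upd x rp dp.
  apply/IB => //; rewrite -subst_upd_env //; apply: nd_allE => //.
  + by rewrite subst_upd_env //; apply: wsub.
  + by have [] := dp (var_sort x).
  + apply: free_for_bv => y /(proj2 (dp (var_sort x))); rewrite bv_fsub.
    exact: contra (bB y).
Qed.

End Forcing.

(** * Reduction to a closed sentence without assumptions *)

Section Conservativity.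
Variable L : signature.
Implicit Types (A B S : formula L) (s : seq (formula L)) (xs : seq (var L)).

Lemma sentence_conservative S :
  (forall R : relsym L, strict_rel R) -> (forall f : funsym L, strict_fun f) ->
  fv S = [::] -> well_sorted S -> eq_free S ->
  fol_derives set0 S -> msl_derives set0 S.
Proof.
move=> strictR strictF S0 wS eS /(fol_sound (X := bv S)) gS.
(* Since [S] is closed, any pure environment serves; this one consists of default variables only. *)
pose r : var L -> point L := fun=> default_term (bv S).
have rp : pure_env (bv S) r by move=> x i; apply: pure_default.
have w0 : world (bv S) set0 by split=> [B []|]; exists [::] => B [].
rewrite -(fsub_closed (env_subst r) S0); apply/(@force_truth _ (bv S)) => //.
exact: gS.
Qed.

Lemma well_sorted_closure xs A : well_sorted (foldr (@All L) A xs) = well_sorted A.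
Proof. by elim: xs. Qed.

Lemma eq_free_closure xs A : eq_free (foldr (@All L) A xs) = eq_free A.
Proof. by elim: xs. Qed.

Lemma mem_fv_closure xs A y :
  (y \in fv (foldr (@All L) A xs)) = (y \notin xs) && (y \in fv A).
Proof. by elim: xs => //= x xs IH; rewrite mem_fv_bind IH inE negb_or andbA. Qed.

Lemma fv_universal_closure A : fv (universal_closure A) = [::].
Proof.
apply/eqP; case E: (fv _) => [//|y ys]; have := mem_head y ys; rewrite -E.
by rewrite mem_fv_closure mem_undup andNb.
Qed.

Lemma fol_closure A : fol_derives set0 A -> fol_derives set0 (universal_closure A).
Proof.
move=> A0; rewrite /universal_closure; elim: undup => //= x xs IH.
exact: nd_allI.
Qed.

Lemma msl_closure G A : msl_derives G (universal_closure A) -> msl_derives G A.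
Proof.
rewrite /universal_closure; elim: undup => //= x xs IH GA; apply: IH.
have := @nd_allE _ _ _ _ G x (Var x) (foldr (@All L) A xs).
rewrite subst_id; apply=> //; [exact: nd_ok GA|exact: Var_sort|exact: free_for_id].
Qed.

Lemma fol_discharge s A : fol_derives (seq_ctx s) A ->
  fol_derives set0 (foldr (@Imp L) A s).
Proof.
(* The induction moves the head of [s] into [G], which therefore has to be arbitrary. *)
suff gen G : fol_derives (G `|` seq_ctx s) A -> fol_derives G (foldr (@Imp L) A s).
  by move=> sA; apply: gen; rewrite set0U.
elim: s G => [|B s IH] G /= sA; first by apply: nd_weak sA => C [|[]].
apply: nd_impI => //; apply: IH; apply: nd_weak sA.
by move=> C [GC|[<-|sC]]; [left; left|left; right|right].
Qed.

Lemma msl_undischarge G s A : seq_ctx s `<=` G -> (forall B, G B -> well_sorted B) ->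
  well_sorted A -> msl_derives G (foldr (@Imp L) A s) -> msl_derives G A.
Proof.
move=> sG wG wA; elim: s sG => //= B s IH sG GA; apply: IH => [C sC|].
  by apply: sG; right.
have GB : G B by apply: sG; left.
have [_ ws] := nd_ok GA.
by apply: nd_impE GA _ => //; apply: nd_hyp => //; apply: wG.
Qed.

End Conservativity.

(** The sorted equality axioms are among the unsorted ones, and the unsorted calculus admits every
    formula and every instantiating term. *)
Lemma msl_fol (L : signature) (G : set (formula L)) A :
  msl_derives G A -> fol_derives G A.
Proof.
apply: nd_mono => // B; case; [exact: fol_refl|..] => *;
  [exact: fol_sym|exact: fol_trans|exact: fol_rel|exact: fol_fun].
Qed.

Theorem theorem3p1 (L : signature)
  (strictR : forall R : relsym L, strict_rel R)
  (strictF : forall f : funsym L, strict_fun f)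
  (G : set (formula L)) (A : formula L)
  (wsG : forall B, G B -> well_sorted B) (wsA : well_sorted A)
  (eqfG : forall B, G B -> eq_free B) (eqfA : eq_free A) :
  msl_derives G A <-> fol_derives G A.
Proof.
split; first exact: msl_fol.
(* A finite part of [G] is discharged into implications and the result universally closed. Once this
   sentence is transferred, instantiation and modus ponens recover [A] inside the many-sorted
   calculus. *)
move=> /nd_compact[s sG /fol_discharge/fol_closure sA].
apply: (msl_undischarge sG) => //; apply: msl_closure.
apply: (@nd_weak _ _ _ _ set0) => //; apply: sentence_conservative => //.
- exact: fv_universal_closure.
- rewrite well_sorted_closure; elim: s sG {sA} => //= B s IH sG.
  by split; [apply: wsG; apply: sG; left|apply: IH => C sC; apply: sG; right].
- rewrite eq_free_closure; elim: s sG {sA} => //= B s IH sG.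
  by rewrite eqfG ?IH // => [C sC|]; apply: sG; [right|left].
Qed.
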